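(* Let $\beta_0,\beta_1\in(1/2,1)$ with $\beta_0\ge\beta_1$ and let $I=[0,\beta_1/(1-\beta_1)]$. For all $x\in I$ the lazy expansion $l(x)\in\Sigma=\{0,1\}^{\mathbb{N}}$ with respect to $(\beta_0,\beta_1)$, whose digits are $l_i=\lceil(1-\beta_1)(\beta_0\beta_1)^{-1}L^{i-1}(x)\rceil-1$, is a $(\beta_0,\beta_1)$-expansion of $x$, that is, $\pi_{\beta_0,\beta_1}(l(x))=x$.
   Context: Let $\Sigma=\{0,1\}^{\mathbb{N}}$ be the set of sequences $s=(s_i)_{i\ge1}$ of zeros and ones. For $s\in\Sigma$ and $n\ge1$, let $0_n(s)$ be the number of zeros and $1_n(s)$ the number of ones among $s_1,\dots,s_n$. For $\beta_0,\beta_1\in(1/2,1)$ with $\beta_0\ge\beta_1$ and $I=[0,\beta_1/(1-\beta_1)]$, define $\pi_{\beta_0,\beta_1}:\Sigma\to I$ by $$\pi_{\beta_0,\beta_1}(s)=\sum_{i=1}^{\infty}s_i\,\beta_0^{0_i(s)}\beta_1^{1_i(s)}.$$ A sequence $s\in\Sigma$ with $\pi_{\beta_0,\beta_1}(s)=x$ is called a $(\beta_0,\beta_1)$-expansion of $x\in I$. Let $T_0,T_1:I\to I$ be the contractions $T_0(x)=\beta_0x$ and $T_1(x)=\beta_1x+\beta_1$, so that $T_0(I)=[0,\beta_0\beta_1/(1-\beta_1)]$. Define $L:I\to I$ by $L(x)=T_0^{-1}(x)=\beta_0^{-1}x$ for $x\in T_0(I)=[0,\beta_0\beta_1/(1-\beta_1)]$,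 and $L(x)=T_1^{-1}(x)=\beta_1^{-1}x-1$ for $x\notin T_0(I)$, that is, for $x\in(\beta_0\beta_1/(1-\beta_1),\beta_1/(1-\beta_1)]$. For $x\in I$ the lazy expansion $l=l(x)=(l_i)_{i\ge1}\in\Sigma$ with respect to $(\beta_0,\beta_1)$ is given by $$l_i=\lceil(1-\beta_1)(\beta_0\beta_1)^{-1}L^{i-1}(x)\rceil-1,$$ where $\lceil a\rceil$ is the smallest integer not smaller than $a$ and $L^{i-1}$ is the $(i-1)$-th iterate of $L$.
   Formalization: At x = 0 the digit formula gives ⌈0⌉ − 1 = −1 for every i, which is not a digit in {0,1}; the lazy expansion of 0 is instead taken to be 000…, while for x > 0 the digits are exactly those of the formula. *)

(* Defs.v *)
From mathcomp Require Import all_boot all_order all_algebra.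
From mathcomp Require Import all_classical all_reals all_analysis.
Set Implicit Arguments.
Unset Strict Implicit.
Unset Printing Implicit Defensive.
Import Order.TTheory GRing.Theory Num.Theory.
Import numFieldNormedType.Exports.
Local Open Scope classical_set_scope.
Local Open Scope ring_scope.

(* Binary sequences are indexed from 0: the digit usually written s_i, i >= 1,
   is [s i.-1]. *)
Definition binseq := nat -> bool.

Definition zeros (s : binseq) (n : nat) : nat := (\sum_(i < n) ~~ s i)%N.
Definition ones (s : binseq) (n : nat) : nat := (\sum_(i < n) s i)%N.

Definition exp_term (R : realType) (b0 b1 : R) (s : binseq) (i : nat) : R :=
  (s i)%:R * b0 ^+ zeros s i.+1 * b1 ^+ ones s i.+1.

(* The limit is genuine for 0 <= b1 <= b0 < 1, see [is_cvg_exp_series]. *)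
Definition pi_beta (R : realType) (b0 b1 : R) (s : binseq) : R :=
  limn (series (exp_term b0 b1 s)).

Definition is_expansion (R : realType) (b0 b1 : R) (s : binseq) (x : R) : Prop :=
  pi_beta b0 b1 s = x.

(* Only the values on [0, b1 / (1 - b1)] matter; this interval is stable under
   the map. *)
Definition lazy_map (R : realType) (b0 b1 : R) (x : R) : R :=
  if x \in `[0, b0 * b1 / (1 - b1)] then b0^-1 * x else b1^-1 * x - 1.

Definition lazy_digit (R : realType) (b0 b1 x : R) (i : nat) : int :=
  Num.ceil ((1 - b1) * (b0 * b1)^-1 * iter i (lazy_map b0 b1) x) - 1.

(* On [0, b1 / (1 - b1)], [lazy_digit] is 0 or 1 except at x = 0, where the ceiling
   formula gives -1 for every index; the digits of the lazy expansion of 0 are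
   taken to be 0. *)
Definition lazy_expansion (R : realType) (b0 b1 x : R) : binseq :=
  fun i => lazy_digit b0 b1 x i == 1.

Lemma zerosDones (s : binseq) n : (zeros s n + ones s n)%N = n.
Proof.
rewrite /zeros /ones -big_split /= (eq_bigr (fun=> 1%N)).
  by rewrite sum1_card card_ord.
by move=> i _; case: (s i).
Qed.

Lemma is_cvg_exp_series (R : realType) (b0 b1 : R) (s : binseq) :
  0 <= b1 -> b1 <= b0 -> b0 < 1 -> cvgn (series (exp_term b0 b1 s)).
Proof.
move=> b1_ge0 le_b b0_lt1.
have b0_ge0 : 0 <= b0 by exact: le_trans le_b.
apply: (@series_le_cvg _ _ (geometric b0 b0)).
- by move=> n; rewrite /exp_term !mulr_ge0 // exprn_ge0.
- by move=> n; rewrite /geometric /= mulr_ge0 // exprn_ge0.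
- move=> n; rewrite /geometric /= -exprS -[in leRHS](zerosDones s n.+1) exprD.
  rewrite /exp_term -mulrA; case: (s n); rewrite ?mul1r ?mul0r.
    by rewrite ler_wpM2l ?exprn_ge0 // lerXn2r ?nnegrE.
  by rewrite mulr_ge0 // exprn_ge0.
- by apply: is_cvg_geometric_series; rewrite ger0_norm.
Qed.

(* Main.v *)
(* With [y_i] the lazy orbit of [x] and [w_n = b0 ^ 0_n b1 ^ 1_n], each step of
   the lazy map reads [y_i = b_d (d + y_(i+1))] where [d] is the i-th digit, so
   [x] is the n-th partial sum plus [w_n y_n].  The orbit stays in
   [0, b1 / (1 - b1)] and [w_n <= b0 ^ n], so this remainder vanishes. *)
Require Import Defs.
From mathcomp Require Import all_boot all_order all_algebra.
From mathcomp Require Import all_classical all_reals all_analysis.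
From mathcomp Require Import ring lra.
Import Order.TTheory GRing.Theory Num.Theory.
Import numFieldNormedType.Exports.
Local Open Scope classical_set_scope.
Local Open Scope ring_scope.

Lemma zerosS (s : binseq) n : zeros s n.+1 = (zeros s n + ~~ s n)%N.
Proof. by rewrite /zeros big_ord_recr. Qed.

Lemma onesS (s : binseq) n : ones s n.+1 = (ones s n + s n)%N.
Proof. by rewrite /ones big_ord_recr. Qed.

(** This is the slope of the composition of the first [n] contractions $T_{s_1} \circ \dots \circ
    T_{s_n}$. *)
Definition exp_weight {R : realType} (b0 b1 : R) (s : binseq) (n : nat) : R :=
  b0 ^+ zeros s n * b1 ^+ ones s n.

Lemma exp_weight_ge0 (R : realType) (b0 b1 : R) (s : binseq) n :
  0 <= b0 -> 0 <= b1 -> 0 <= exp_weight b0 b1 s n.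
Proof. by move=> b0_ge0 b1_ge0; rewrite mulr_ge0 ?exprn_ge0. Qed.

(** The two exponents add up to [n], so it suffices to trade each factor [b1] for the larger
    [b0]. *)
Lemma exp_weight_le (R : realType) (b0 b1 : R) (s : binseq) n :
  0 <= b1 -> b1 <= b0 -> exp_weight b0 b1 s n <= b0 ^+ n.
Proof.
move=> b1_ge0 le_b; have b0_ge0 : 0 <= b0 by exact: le_trans le_b.
rewrite /exp_weight -[in leRHS](zerosDones s n) exprD.
by rewrite ler_wpM2l ?exprn_ge0 // lerXn2r ?nnegrE.
Qed.

Section LazyMap.
Context {R : realType} (b0 b1 : R).
Hypotheses (hb0 : b0 \in `]2^-1, 1[) (hb1 : b1 \in `]2^-1, 1[).

Let b0_bounds : (2^-1 < b0) /\ (b0 < 1).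
Proof. by move: hb0; rewrite in_itv /= => /andP[]. Qed.

Let b1_bounds : (2^-1 < b1) /\ (b1 < 1).
Proof. by move: hb1; rewrite in_itv /= => /andP[]. Qed.

Let b0_gt0 : 0 < b0. Proof. by case: b0_bounds; lra. Qed.
Let b1_gt0 : 0 < b1. Proof. by case: b1_bounds; lra. Qed.
Let subb1_gt0 : 0 < 1 - b1. Proof. by case: b1_bounds; lra. Qed.

Lemma lazy_map_lt y : b0 * b1 / (1 - b1) < y -> lazy_map b0 b1 y = b1^-1 * y - 1.
Proof. by move=> lty; rewrite /lazy_map in_itv /= [y <= _]leNgt lty andbF. Qed.

Lemma lazy_map_ge y :
  0 <= y -> y <= b0 * b1 / (1 - b1) -> lazy_map b0 b1 y = b0^-1 * y.
Proof. by move=> y_ge0 ley; rewrite /lazy_map in_itv /= y_ge0 ley. Qed.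

(** On the upper branch, [b0 + b1 > 1] puts the threshold [b0 * b1 / (1 - b1)] at or above [b1], so
    [b1^-1 * y] exceeds 1. Hence an orbit that starts above 0 never reaches 0, the one point with
    digit -1. *)
Lemma lazy_map_gt0 y : 0 < y -> 0 < lazy_map b0 b1 y.
Proof.
move=> y_gt0; have [ley|lty] := leP y (b0 * b1 / (1 - b1)).
  by rewrite (lazy_map_ge _ (ltW y_gt0) ley) mulr_gt0 ?invr_gt0.
rewrite lazy_map_lt // subr_gt0 mulrC ltr_pdivlMr // mul1r.
apply: le_lt_trans lty; rewrite ler_pdivlMr // mulrC ler_wpM2r ?ltW //.
by case: b0_bounds b1_bounds => ? _ [? _]; lra.
Qed.

Lemma lazy_map_itv y :
  y \in `[0, b1 / (1 - b1)] -> lazy_map b0 b1 y \in `[0, b1 / (1 - b1)].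
Proof.
rewrite !in_itv /= => /andP[y_ge0 ley].
have -> : 0 <= lazy_map b0 b1 y.
  move: y_ge0; rewrite le_eqVlt => /predU1P[<-|/lazy_map_gt0/ltW//].
  by rewrite lazy_map_ge ?mulr0 // mulr_ge0 ?invr_ge0 ?mulr_ge0 ?ltW.
(* The lower branch sends the threshold exactly to the right endpoint of the interval; on the upper
   branch that endpoint is a fixed point. *)
have [leyc|lty] := leP y (b0 * b1 / (1 - b1)).
  by rewrite lazy_map_ge //= mulrC ler_pdivrMr // mulrC mulrA.
rewrite lazy_map_lt //= lerBlDr mulrC ler_pdivrMr //.
suff -> : (b1 / (1 - b1) + 1) * b1 = b1 / (1 - b1) by [].
by field; rewrite gt_eqF.
Qed.

Lemma iter_lazy_map_itv x i :
  x \in `[0, b1 / (1 - b1)] ->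
  iter i (lazy_map b0 b1) x \in `[0, b1 / (1 - b1)].
Proof. by move=> hx; elim: i => //= i; exact: lazy_map_itv. Qed.

(** The normalised orbit point is above 1 past the threshold and at most [b0^-1] on the whole
    interval. Since [b0 > 1/2], this is below 2 and the ceiling is 2. *)
Lemma lazy_digit_lt x i (y := iter i (lazy_map b0 b1) x) :
  x \in `[0, b1 / (1 - b1)] -> b0 * b1 / (1 - b1) < y ->
  lazy_digit b0 b1 x i = 1.
Proof.
move=> /(iter_lazy_map_itv _ i); rewrite in_itv /= -/y => /andP[_ ley] lty.
suff: Num.ceil ((1 - b1) * (b0 * b1)^-1 * y) = 2 by rewrite /lazy_digit => ->.
have b01_gt0 : 0 < b0 * b1 by rewrite mulr_gt0.
apply: ceil_def; apply/andP; split.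
  rewrite (_ : (2 - 1)%:~R = 1 :> R) //.
  by rewrite mulrAC ltr_pdivlMr // mul1r [ltRHS]mulrC -ltr_pdivrMr.
rewrite mulrAC ler_pdivrMr //.
move: ley; rewrite ler_pdivlMr // mulrC => /le_trans; apply.
rewrite mulrA ler_peMl ?ltW //.
by case: b0_bounds; lra.
Qed.

Lemma lazy_digit_ge x i (y := iter i (lazy_map b0 b1) x) :
  0 < y -> y <= b0 * b1 / (1 - b1) -> lazy_digit b0 b1 x i = 0.
Proof.
move=> y_gt0 ley.
suff: Num.ceil ((1 - b1) * (b0 * b1)^-1 * y) = 1 by rewrite /lazy_digit => ->.
have b01_gt0 : 0 < b0 * b1 by rewrite mulr_gt0.
apply: ceil_def; rewrite subrr; apply/andP; split.
  by rewrite !mulr_gt0 // invr_gt0.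
by rewrite mulrAC ler_pdivrMr // mul1r mulrC -ler_pdivlMr.
Qed.

Lemma lazy_expansionE x i :
  x \in `[0, b1 / (1 - b1)] ->
  lazy_expansion b0 b1 x i =
    (b0 * b1 / (1 - b1) < iter i (lazy_map b0 b1) x).
Proof.
move=> hx; rewrite /lazy_expansion; case: ltP => [lty|ley].
  by rewrite lazy_digit_lt.
have := iter_lazy_map_itv _ i hx; rewrite in_itv /= => /andP[+ _].
(* At an orbit point equal to 0 the integer digit is -1, which still differs from 1, so the boolean
   digit is false as required. *)
rewrite le_eqVlt => /predU1P[y0|y_gt0]; last by rewrite lazy_digit_ge.
by rewrite /lazy_digit -y0 mulr0 ceil0.
Qed.

(** The boolean encoding is faithful to the ceiling formula for [x > 0]: the whole orbit then stays
    positive, which rules out the digit -1. *)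
Lemma lazy_expansion_digit x i :
  x \in `[0, b1 / (1 - b1)] -> 0 < x ->
  Posz (lazy_expansion b0 b1 x i) = lazy_digit b0 b1 x i.
Proof.
move=> hx x_gt0; rewrite lazy_expansionE //.
have [ley|lty] := leP; last by rewrite lazy_digit_lt.
by rewrite lazy_digit_ge //; elim: i {ley} => //= i; exact: lazy_map_gt0.
Qed.

Lemma lazy_remainder x n (s := lazy_expansion b0 b1 x) :
  x \in `[0, b1 / (1 - b1)] ->
  x = series (exp_term b0 b1 s) n
      + exp_weight b0 b1 s n * iter n (lazy_map b0 b1) x.
Proof.
move=> hx; elim: n => [|n IHn].
  by rewrite seriesEord /exp_weight /zeros /ones /= !big_ord0 !mul1r add0r.
rewrite [LHS]IHn seriesSr -[RHS]addrA; congr (_ + _).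
rewrite /exp_term /exp_weight zerosS onesS iterS.
have := iter_lazy_map_itv _ n hx; rewrite in_itv /= => /andP[y_ge0 _].
rewrite /s (lazy_expansionE _ n) //; case: ltP => [lty|ley] /=.
  rewrite lazy_map_lt // addn0 addn1 exprS; field; exact: lt0r_neq0.
rewrite lazy_map_ge // addn0 addn1 exprS; field; exact: lt0r_neq0.
Qed.

End LazyMap.

Theorem proposition3p2 (R : realType) (b0 b1 : R)
  (hb0 : b0 \in `]2^-1, 1[) (hb1 : b1 \in `]2^-1, 1[) (hb : b1 <= b0)
  (x : R) (hx : x \in `[0, b1 / (1 - b1)]) :
  (0 < x -> forall i : nat,
     Posz (lazy_expansion b0 b1 x i) = lazy_digit b0 b1 x i) /\
  is_expansion b0 b1 (lazy_expansion b0 b1 x) x.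
Proof.
split=> [x_gt0 i|]; first exact: lazy_expansion_digit.
have [b0_gt b0_lt1] : 2^-1 < b0 /\ b0 < 1.
  by move: hb0; rewrite in_itv /= => /andP[].
have b1_ge0 : 0 <= b1 by move: hb1; rewrite in_itv /= => /andP[]; lra.
have b0_ge0 : 0 <= b0 by lra.
set s := lazy_expansion b0 b1 x.
set y := fun n => iter n (lazy_map b0 b1) x.
have rem_cvg0 : exp_weight b0 b1 s n * y n @[n --> \oo] --> (0 : R).
  apply: (@squeeze_cvgr _ _ _ _ (fun=> 0) (geometric (b1 / (1 - b1)) b0)).
  - near=> n; have := iter_lazy_map_itv _ _ hb0 hb1 x n hx.
    rewrite in_itv /= -/(y n) => /andP[y_ge0 ley].
    rewrite mulr_ge0 ?exp_weight_ge0 //= [leRHS]mulrC.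
    by rewrite ler_pM ?exp_weight_ge0 ?exp_weight_le.
  - exact: cvg_cst.
  - by apply: cvg_geometric; rewrite ger0_norm.
(* The value of [pi_beta] is a limit, so it is enough that the partial sums converge to [x]; by
   [lazy_remainder] they equal [x] minus a null sequence. *)
apply/cvg_lim => //.
have -> : series (exp_term b0 b1 s) =
          (fun n => x - exp_weight b0 b1 s n * y n).
  apply/funext => n; rewrite [in RHS](lazy_remainder _ _ hb0 hb1 x n hx).
  by rewrite addrK.
by rewrite -[X in _ --> X]subr0; apply: cvgB => //; exact: cvg_cst.
Unshelve. all: by end_near. Qed.
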